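(* Let $\mathbf{X}_n$, $n\in\mathbb{Z}_+$, be a $p$-type Galton--Watson process (with immigration, as defined in the context). If the process is subcritical, i.e. $\varrho(\mathbf{M})<1$, then it has an aperiodic communication class $\mathcal{C}\subseteq\mathbb{Z}_+^p$ such that, for any initial distribution (any distribution of $\mathbf{X}_0$ on $\mathbb{Z}_+^p$), the process reaches $\mathcal{C}$ in finitely many steps with probability 1.
   Context: $\mathbb{Z}_+$ is the set of nonnegative integers and $p$ is a positive integer. A $p$-type Galton--Watson process $\mathbf{X}_n=(X_{n,1},\dots,X_{n,p})^\top$, $n\in\mathbb{Z}_+$, is a $\mathbb{Z}_+^p$-valued Markov chain defined by the recursion $$\mathbf{X}_n=\sum_{i=1}^p\sum_{k=1}^{X_{n-1,i}}\boldsymbol{\xi}_i(n,k)+\boldsymbol{\eta}(n),\qquad n=1,2,\dots,$$ where the $\mathbb{Z}_+^p$-valued random vectors $\mathbf{X}_0$, $\boldsymbol{\xi}_i(n,k)$, $\boldsymbol{\eta}(n)$ ($i=1,\dots,p$; $n,k=1,2,\dots$) are independent of each other; for each $i$ the offspring variables $\boldsymbol{\xi}_i(n,k)$, $n,k\ge1$, are identically distributed; and the innovation variables $\boldsymbol{\eta}(n)$, $n\ge1$, are identically distributed. (The components of a single offspring or innovation vector may be dependent.) Standing assumption: all offspring variables have finite expectation. The mean matrix is $\mathbf{M}=[E\boldsymbol{\xi}_1(1,1),\dots,E\boldsymbol{\xi}_p(1,1)]^\top$ (so $M_{i,j}$ is the expectation of the $j$-th component of $\boldsymbol{\xi}_i(1,1)$),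 $\varrho(\mathbf{M})$ is its spectral radius, and the process is called subcritical if $\varrho(\mathbf{M})<1$. Communication classes and aperiodicity are in the usual sense for time-homogeneous Markov chains on a countable state space. *)

(* Defs.v *)
From HB Require Import structures.
From mathcomp Require Import all_boot all_order all_algebra finmap complex.
From mathcomp Require Import all_classical all_reals all_analysis.

Set Implicit Arguments.
Unset Strict Implicit.
Unset Printing Implicit Defensive.

Import Order.TTheory GRing.Theory Num.Theory.
Local Open Scope classical_set_scope.
Local Open Scope ring_scope.

Section RandomElements.
Context {R : realType} {S : Type}.

(* [S] carries its full power set as sigma-algebra; the definitions below are
   only used for the countable type [S = 'cV[nat]_p]. *)
Definition random_element {d} {T : measurableType d} (Y : T -> S) : Prop :=
  forall A : set S, measurable (Y @^-1` A).

Definition same_law {d d'} {T : measurableType d} {T' : measurableType d'}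
    (P : probability T R) (P' : probability T' R)
    (Y : T -> S) (Y' : T' -> S) : Prop :=
  forall A : set S, P (Y @^-1` A) = P' (Y' @^-1` A).

Definition mutually_independent {d} {T : measurableType d}
    (P : probability T R) {I : choiceType} (Y : I -> T -> S) : Prop :=
  forall (J : {fset I}) (A : I -> set S),
    P (\bigcap_(j in [set` J]) (Y j @^-1` A j)) =
    (\prod_(j <- J) P (Y j @^-1` A j))%E.

End RandomElements.

Section MarkovChain.
Context {R : realType} {S : choiceType}.
Variable Q : S -> S -> \bar R.

Fixpoint nstep (n : nat) (x y : S) : \bar R :=
  if n is m.+1 then (\esum_(z in [set: S]) (Q x z * nstep m z y))%E
  else ((x == y)%:R)%:E.

Definition accessible (x y : S) : Prop := exists n, (0 < nstep n x y)%E.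

Definition communicate (x y : S) : Prop := accessible x y /\ accessible y x.

Definition communication_class (C : set S) : Prop :=
  exists x, C = [set y | communicate x y].

(* With this definition the greatest common divisor of the empty set (and of
   [[set 0]]) is [0]. *)
Definition is_gcd (A : set nat) (g : nat) : Prop :=
  (forall n, A n -> (g %| n)%N) /\
  (forall e, (forall n, A n -> (e %| n)%N) -> (e %| g)%N).

Definition has_period (x : S) (g : nat) : Prop :=
  is_gcd [set n | (0 < n)%N /\ (0 < nstep n x x)%E] g.

Definition aperiodic (C : set S) : Prop := forall x, C x -> has_period x 1.

End MarkovChain.

(* The set of moduli is finite, so the supremum is a maximum when [0 < p]. *)
Definition spectral_radius {R : realType} {p : nat} (M : 'M[R]_p) : R :=
  sup [set Normc.normc z | z in
        [set z : R[i] | eigenvalue (map_mx (real_complex R) M) z]].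

(* Index type for joint independence of the initial state [inl (inl tt)], the
   offspring vectors [inl (inr (i, n, k))] and the innovations [inr n]. *)
Definition gw_index (p : nat) : choiceType :=
  (unit + ('I_p * nat * nat) + nat)%type.

Definition gw_family {T : Type} {p : nat} (X0 : T -> 'cV[nat]_p)
    (xi : 'I_p -> nat -> nat -> T -> 'cV[nat]_p)
    (eta : nat -> T -> 'cV[nat]_p) (j : gw_index p) : T -> 'cV[nat]_p :=
  match j with
  | inl (inl _) => X0
  | inl (inr (i, n, k)) => xi i n k
  | inr n => eta n
  end.

(* Indices [n] and [k] start at [0]: [gw_xi i n k] is the offspring vector
   xi_i(n+1,k+1) and [gw_eta n] is the innovation eta(n+1). *)
Record gw_process (R : realType) (p : nat) := GWProcess {
  gw_display : measure_display;
  gw_space : measurableType gw_display;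
  gw_P : probability gw_space R;
  gw_X0 : gw_space -> 'cV[nat]_p;
  gw_xi : 'I_p -> nat -> nat -> gw_space -> 'cV[nat]_p;
  gw_eta : nat -> gw_space -> 'cV[nat]_p;
  gw_random : forall j, random_element (gw_family gw_X0 gw_xi gw_eta j);
  gw_independent : mutually_independent gw_P (gw_family gw_X0 gw_xi gw_eta);
  gw_xi_ident : forall i n k,
    same_law gw_P gw_P (gw_xi i n k) (gw_xi i 0%N 0%N);
  gw_eta_ident : forall n, same_law gw_P gw_P (gw_eta n) (gw_eta 0%N)
}.

Section GaltonWatson.
Context {R : realType} {p : nat}.
Implicit Types W : gw_process R p.

Fixpoint gw_X W (n : nat) (w : gw_space W) : 'cV[nat]_p :=
  if n is m.+1 then
    \sum_(i < p) \sum_(k < gw_X m w i ord0) gw_xi i m k w + gw_eta m w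
  else gw_X0 w.

(* The one-step transition probabilities; as the driving vectors are i.i.d. in
   time, they are given by the first step of the recursion. *)
Definition gw_trans W (x y : 'cV[nat]_p) : \bar R :=
  gw_P W [set w : gw_space W |
    \sum_(i < p) \sum_(k < x i ord0) gw_xi i 0%N k w + gw_eta 0%N w = y].

Definition gw_finite_mean W : Prop :=
  forall i j, (gw_P W).-integrable [set: gw_space W]
    (fun w => ((gw_xi i 0%N 0%N w j ord0)%:R : R)%:E).

Definition gw_mean W : 'M[R]_p :=
  \matrix_(i, j)
    fine ('E_(gw_P W)[fun w : gw_space W => (gw_xi i 0%N 0%N w j ord0)%:R]).

Definition subcritical W : Prop := spectral_radius (gw_mean W) < 1.

(* Letting [W'] range over these processes realizes ``for any initial
   distribution'': its probability space and initial law are unconstrained. *)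
Definition same_dynamics W W' : Prop :=
  (forall i, same_law (gw_P W) (gw_P W')
     (@gw_xi R p W i 0%N 0%N) (@gw_xi R p W' i 0%N 0%N)) /\
  same_law (gw_P W) (gw_P W') (@gw_eta R p W 0%N) (@gw_eta R p W' 0%N).

End GaltonWatson.

(* Main.v *)
From HB Require Import structures.
Require Import Defs.
From mathcomp Require Import all_boot all_order all_algebra finmap complex.
From mathcomp Require Import all_classical all_reals all_analysis ring lra.

(* Let q_n(i) be the probability that the lineage of one individual of type i,
   immigration excluded, has died out by generation n. Then 1 - q_n(i) is at
   most the i-th row sum of M^n, which tends to 0 because the eigenvalues of M
   lie in the open unit disc; hence q_n -> 1. Once the lineages of the initial
   individuals are extinct the process behaves as if it had been started from 0,
   so P^n(a + b, .) >= prod_i q_n(i)^{a_i} P^n(b, .). Choose K with q_n(i) > 0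
   for all n >= K and all i, and a state z with P^K(0, z) > 0. Then P^n(x, z) > 0
   for every state x and every n >= K, so the class C of z is closed and
   aperiodic. For n >= K the chain started from 0 is almost surely in C at time
   n, so P_x(X_n in C) >= prod_i q_n(i)^{x_i}, which tends to 1. *)

Set Implicit Arguments.
Unset Strict Implicit.
Unset Printing Implicit Defensive.

Import Order.TTheory GRing.Theory Num.Theory.
Import numFieldNormedType.Exports.
Local Open Scope classical_set_scope.
Local Open Scope ring_scope.

(** * Sums over countable sets and expectations of independent sums *)

Section Esum.
Context {R : realType}.
Local Open Scope ereal_scope.

Lemma esum_ge_term (T : choiceType) (f : T -> \bar R) t :
  (forall s, 0 <= f s) -> f t <= \esum_(s in [set: T]) f s.
Proof.
move=> f0; apply: esum_ge; exists [set t]; last by rewrite fsbig_set1.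
by split => //; exact: finite_set1.
Qed.

Lemma esumZl (T : choiceType) (c : \bar R) (f : T -> \bar R) :
  0 <= c -> (forall s, 0 <= f s) ->
  \esum_(s in [set: T]) (c * f s) = c * \esum_(s in [set: T]) f s.
Proof.
(* One inequality for every factor; applied again to [c^-1] it yields the converse when [c] is
   finite and positive. *)
have leZ (d : \bar R) (g : T -> \bar R) : 0 <= d -> (forall s, 0 <= g s) ->
    \esum_(s in [set: T]) (d * g s) <= d * \esum_(s in [set: T]) g s.
  move=> d0 g0; apply: ge_ereal_sup => _ [X [finX _] <-].
  rewrite -ge0_mule_fsumr//; apply: lee_wpmul2l => //.
  by apply: esum_ge; exists X.
move=> c0 f0; apply/eqP; rewrite eq_le leZ//=.
case: c c0 => [c||]//; last first.
  move=> _; have [->|] := eqVneq (\esum_(s in [set: T]) f s) 0.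
    by rewrite mule0 esum_ge0// => s _; rewrite mule_ge0.
  move=> nz; have [t ft] : exists t, f t != 0.
    apply: contrapT => /forallNP f00; move/eqP: nz; apply.
    by apply: esum1 => s _; apply/eqP; apply/negPn/negP; exact: f00.
  apply: (@le_trans _ _ (+oo * f t)).
    by rewrite [leRHS]gt0_mulye ?leey// lt0e ft f0.
  by apply: (@esum_ge_term _ (fun s => +oo * f s)) => s; rewrite mule_ge0.
rewrite lee_fin => c0; move: c0; rewrite [(0 <= c)%R]le_eqVlt => /predU1P[<-|c0].
  by rewrite mul0e esum_ge0// => s _; rewrite mul0e.
have E g : g = c%:E * (c^-1%:E * g) by rewrite muleA -EFinM divff ?gt_eqF// mul1e.
rewrite [leRHS]E; apply: lee_wpmul2l; first by rewrite lee_fin ltW.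
apply: (le_trans _ (leZ _ _ _ _)).
- by apply: le_esum => s _; rewrite muleA -EFinM mulVf ?gt_eqF// mul1e.
- by rewrite lee_fin invr_ge0 ltW.
- by move=> s; rewrite mule_ge0// lee_fin ltW.
Qed.

Lemma esumZr (T : choiceType) (c : \bar R) (f : T -> \bar R) :
  0 <= c -> (forall s, 0 <= f s) ->
  \esum_(s in [set: T]) (f s * c) = (\esum_(s in [set: T]) f s) * c.
Proof.
by move=> c0 f0; rewrite muleC -esumZl//; apply: eq_esum => s _; rewrite muleC.
Qed.

Lemma exchange_esum (T1 T2 : choiceType) (a : T1 -> T2 -> \bar R) :
  (forall i j, 0 <= a i j) ->
  \esum_(i in [set: T1]) \esum_(j in [set: T2]) a i j =
  \esum_(j in [set: T2]) \esum_(i in [set: T1]) a i j.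
Proof.
move=> a0; rewrite !esum_esum//.
rewrite (@reindex_esum _ _ _ ([set: T2] `*`` fun=> [set: T1]) _
  (fun x => (x.2, x.1)))//.
split=> //.
- by move=> [x1 x2] [y1 y2] _ _ /= [-> ->].
- by move=> [x1 x2] _; exists (x2, x1).
Qed.

Lemma esum_delta (T : choiceType) (x : T) (h : T -> \bar R) :
  (forall y, 0 <= h y) ->
  \esum_(y in [set: T]) (x == y)%:R%:E * h y = h x.
Proof.
move=> h0; rewrite -(esum_set1 (h0 x)) [RHS]esum_mkcond.
apply: eq_esum => y _; rewrite in_set1 eq_sym.
by case: eqP => _; rewrite ?mul1e ?mul0e.
Qed.

End Esum.

Section ExpectSum.
Context {R : realType} {S : nmodType}.
Local Open Scope ereal_scope.
Implicit Types (f g : S -> \bar R) (h : S -> \bar R) (F : seq (S -> \bar R)).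

(* [expect_sum F h] is the expectation of [h] at a sum of independent variables
   whose laws are the point masses in the list [F]. *)
Fixpoint expect_sum F h : \bar R :=
  if F is f :: F' then
    \esum_(a in [set: S]) f a * expect_sum F' (fun b => h (a + b)%R)
  else h 0%R.

Definition nneg_all F := forall f, f \in F -> forall a, 0 <= f a.

Lemma nneg_all_cons f F : nneg_all (f :: F) -> (forall a, 0 <= f a) /\ nneg_all F.
Proof. 
move=> H; split=> [|g gF]; apply: H; first exact: mem_head.
by rewrite in_cons gF orbT. Qed.

Lemma expect_sum_ge0 F h : nneg_all F -> (forall a, 0 <= h a) ->
  0 <= expect_sum F h.
Proof.
elim: F h => [|f F IH] h //= /nneg_all_cons[f0 F0] h0.
by apply: esum_ge0 => a _; rewrite mule_ge0// IH.
Qed.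

Lemma eq_expect_sum F h h' : h =1 h' -> expect_sum F h = expect_sum F h'.
Proof. by move=> /funext ->. Qed.

Lemma le_expect_sum F h h' : nneg_all F -> (forall a, 0 <= h a) ->
  (forall a, h a <= h' a) -> expect_sum F h <= expect_sum F h'.
Proof.
elim: F h h' => [|f F IH] h h' //= /nneg_all_cons[f0 F0] h0 hh'.
by apply: le_esum => a _; apply: lee_wpmul2l => //; exact: IH.
Qed.

Lemma expect_sumZ F h c : nneg_all F -> (forall a, 0 <= h a) -> 0 <= c ->
  expect_sum F (fun a => h a * c) = expect_sum F h * c.
Proof.
elim: F h => [|f F IH] h //= /nneg_all_cons[f0 F0] h0 c0.
rewrite -esumZr// => [|a]; last by rewrite mule_ge0// expect_sum_ge0.
by apply: eq_esum => a _; rewrite IH// muleA.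
Qed.

Lemma expect_sum_cat F G h :
  expect_sum (F ++ G) h =
  expect_sum F (fun a => expect_sum G (fun b => h (a + b)%R)).
Proof.
elim: F h => [|f F IH] h /=.
  by apply: eq_expect_sum => b; rewrite add0r.
apply: eq_esum => a _; rewrite IH; congr (_ * _).
by apply: eq_expect_sum => b; apply: eq_expect_sum => c; rewrite addrA.
Qed.

Lemma expect_sum_swap f g F h : nneg_all [:: f, g & F] -> (forall a, 0 <= h a) ->
  expect_sum [:: f, g & F] h = expect_sum [:: g, f & F] h.
Proof.
move=> /nneg_all_cons[f0] /nneg_all_cons[g0 F0] h0 /=.
have E0 x y : 0 <= expect_sum F (fun b => h (x + (y + b))%R).
  by rewrite expect_sum_ge0.
under eq_esum do (rewrite -esumZl//; last by move=> ?; rewrite mule_ge0).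
rewrite exchange_esum => [|a b]; last by rewrite !mule_ge0.
apply: eq_esum => b _; rewrite -esumZl// => [|a]; last by rewrite mule_ge0.
apply: eq_esum => a _; rewrite muleCA; do 2!congr (_ * _).
by apply: eq_expect_sum => c; rewrite addrCA.
Qed.

(** By Tonelli, neighbouring summands may trade places. This is used because [types (a + b)] is only
    a permutation of [types a ++ types b]. *)
Lemma expect_sum_perm (I : eqType) (law : I -> S -> \bar R) (l l' : seq I) h :
  (forall i a, 0 <= law i a) -> (forall a, 0 <= h a) -> perm_eq l l' ->
  expect_sum (map law l) h = expect_sum (map law l') h.
Proof.
move=> law0; have law_all s : nneg_all (map law s).
  by move=> _ /mapP[i _ ->].
have move_front s1 s2 x k : (forall a, 0 <= k a) ->
    expect_sum (map law (s1 ++ x :: s2)) k =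
    expect_sum (map law (x :: s1 ++ s2)) k.
  elim: s1 k => [|y s1 IH] k k0 //.
  rewrite [RHS]expect_sum_swap//; last exact: (law_all [:: x, y & s1 ++ s2]).
  by apply: eq_esum => a _; congr (_ * _); exact: IH.
elim: l l' h => [|x l IH] l' h h0; first by rewrite perm_sym => /perm_nilP ->.
move=> pll'; have xl' : x \in l' by rewrite -(perm_mem pll') mem_head.
case/splitPr: xl' pll' => l1 l2 pll'; rewrite move_front//=.
apply: eq_esum => a _; congr (_ * _); apply: IH => //.
by rewrite -(perm_cons x) (perm_trans pll')// perm_catC/= perm_cons perm_catC.
Qed.

Lemma expect_sum1 F : (forall f, f \in F -> \esum_(a in [set: S]) f a = 1) ->
  expect_sum F (fun=> 1) = 1.
Proof.
elim: F => [|f F IH] //= F1; rewrite IH => [|g gF]; last by apply: F1; rewrite in_cons gF orbT.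
by rewrite -[RHS](F1 f) ?mem_head//; apply: eq_esum => a _; rewrite mule1.
Qed.

(** For the monomial [all_ext] in the role of [chi], this is the product rule for generating
    functions of independent sums. *)
Lemma expect_sum_mult F (chi : S -> \bar R) : nneg_all F ->
  (forall a, 0 <= chi a) -> chi 0%R = 1 ->
  (forall a b, chi (a + b)%R = chi a * chi b) ->
  expect_sum F chi = \prod_(f <- F) \esum_(a in [set: S]) f a * chi a.
Proof.
move=> F0 chi0 chi1 chiM.
elim: F F0 => [|f F IH] /=; first by rewrite big_nil.
move=> /nneg_all_cons[f0 F0]; rewrite big_cons -IH//.
rewrite -esumZr; [|exact: expect_sum_ge0|by move=> a; rewrite mule_ge0].
apply: eq_esum => a _; rewrite -muleA; congr (_ * _).
rewrite muleC -expect_sumZ//; apply: eq_expect_sum => b.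
by rewrite chiM muleC.
Qed.

(** Change of variables. With [g] the identity it turns [step] into summation against a transition
    kernel. *)
Lemma esum_expect_sum F (g : S -> S) h : nneg_all F -> (forall a, 0 <= h a) ->
  \esum_(y in [set: S]) expect_sum F (fun a => (g a == y)%:R%:E) * h y =
  expect_sum F (h \o g).
Proof.
move=> F0 h0; elim: F F0 g => [|f F IH] F0 g /=; first exact: esum_delta.
move/nneg_all_cons: F0 => [f0 F0].
have E0 y a : 0 <= expect_sum F (fun b => (g (a + b)%R == y)%:R%:E) :> \bar R.
  by apply: expect_sum_ge0 => // b; rewrite lee_fin.
under eq_esum do (rewrite -esumZr//; last by move=> ?; rewrite mule_ge0).
rewrite exchange_esum => [|y a]; last by rewrite !mule_ge0.
apply: eq_esum => a _.
rewrite -[in RHS](IH F0 (fun b => g (a + b)%R)) -esumZl//.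
  by apply: eq_esum => y _; rewrite muleA.
by move=> y; rewrite mule_ge0.
Qed.

End ExpectSum.

(** * Events independent of a family of variables *)

(** Joins the countability of [nat] with its addition, so that ['cV[nat]_p] is a [countNmodType],
    the value type assumed for independence. *)
HB.instance Definition _ := Countable.on nat.

Section CountableUnion.
Context {R : realType} {d} {T : measurableType d}.
Local Open Scope ereal_scope.

(** Numbers that encode no index contribute the empty set; sigma-additivity thus passes from
    sequences to countable index types. *)
Lemma bigcup_pickle (I : countType) (F : I -> set T) :
  \bigcup_i F i = \bigcup_n oapp F set0 (pickle_inv n).
Proof.
apply/seteqP; split=> [t [i _ Ft]|t [n _]].
  by exists (choice.pickle i) => //; rewrite pickleK_inv.
by case: pickle_inv => //= i Ft; exists i.
Qed.

Lemma measurable_bigcup_countType (I : countType) (F : I -> set T) :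
  (forall i, measurable (F i)) -> measurable (\bigcup_i F i).
Proof.
move=> mF; rewrite bigcup_pickle; apply: bigcupT_measurable => n.
by case: pickle_inv => [i|] /=.
Qed.

Lemma measure_bigcup_countType (mu : {measure set T -> \bar R}) (I : countType)
    (F : I -> set T) :
  (forall i, measurable (F i)) -> trivIset setT F ->
  mu (\bigcup_i F i) = \esum_(i in [set: I]) mu (F i).
Proof.
move=> mF tF; rewrite bigcup_pickle measure_semi_bigcup//=; last 3 first.
- by move=> n; case: pickle_inv => [i|] /=.
- apply/trivIsetP => m n _ _ mn.
  case Em : (pickle_inv m) => [i|]/=; last by rewrite set0I.
  case En : (pickle_inv n) => [j|]/=; last by rewrite setI0.
  move/trivIsetP: tF; apply=> //; apply: contra_neq mn => ij.
  have := @pickle_invK I m; have := @pickle_invK I n.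
  by rewrite /ocancel Em En /= ij => <- <-.
- rewrite -bigcup_pickle; exact: measurable_bigcup_countType.
rewrite nneseries_esumT//.
have pI : set_inj [set: I] choice.pickle by move=> i j _ _ /(pcan_inj (@choice.pickleK I)).
transitivity (\esum_(n in choice.pickle @` [set: I]) mu (oapp F set0 (pickle_inv n))).
  rewrite [RHS]esum_mkcond; apply: eq_esum => n _.
  case: ifPn => //; rewrite notin_setE.
  case En : (pickle_inv n) => [i|]//=.
  by case; exists i => //; have := @pickle_invK I n; rewrite En.
rewrite esum_image//; apply: eq_esum => i _.
by rewrite pickleK_inv.
Qed.

End CountableUnion.

Section Independence.
Context {R : realType} {d} {T : measurableType d} (P : probability T R).
Context {I : choiceType} {S : countNmodType} (Y : I -> T -> S).
Hypothesis rY : forall j, random_element (Y j).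
Local Open Scope ereal_scope.

Definition law (j : I) (a : S) : \bar R := P (Y j @^-1` [set a]).

(** When [E] has positive probability: conditionally on [E], the variables with index in [D] are
    independent and keep their laws. *)
Definition indep_event (D : set I) (E : set T) : Prop :=
  measurable E /\ forall (J : {fset I}) (A : I -> set S), [set` J] `<=` D ->
    P (E `&` \bigcap_(j in [set` J]) (Y j @^-1` A j)) =
    P E * \prod_(j <- J) P (Y j @^-1` A j).

Lemma indep_event_subset (D D' : set I) E : D' `<=` D ->
  indep_event D E -> indep_event D' E.
Proof.
by move=> DD' [mE HE]; split=> // J A JD'; apply: HE; exact: subset_trans DD'.
Qed.

Lemma indep_eventT : mutually_independent P Y -> indep_event setT setT.
Proof.
by move=> iY; split=> // J A _; rewrite setTI probability_setT mul1e iY.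
Qed.

Lemma measurable_fset_bigcap (J : {fset I}) (A : I -> set S) :
  measurable (\bigcap_(j in [set` J]) (Y j @^-1` A j)).
Proof. by apply: fin_bigcap_measurable => // j _; exact: rY. Qed.

Lemma indep_eventI (D : set I) E j (B : set S) : D j -> indep_event D E ->
  P (E `&` Y j @^-1` B) = P E * P (Y j @^-1` B) /\
  indep_event (D `\ j) (E `&` Y j @^-1` B).
Proof.
move=> Dj [mE HE].
have EB : P (E `&` Y j @^-1` B) = P E * P (Y j @^-1` B).
  have := HE [fset j]%fset (fun=> B).
  rewrite set_fset1 bigcap_set1 big_seq_fset1; apply.
  by move=> _ ->.
split=> //; split=> [|J A JD]; first by apply: measurableI => //; exact: rY.
have jJ : j \notin J by apply/negP => /JD[_]; exact.
(* The test set [B] is inserted at [j], so that independence for [J] enlarged by [j] gives the claim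
   for [J]. *)
pose A' i := if i == j then B else A i.
have A'J i : i \in J -> A' i = A i.
  by rewrite /A'; case: eqP => // ->; rewrite (negbTE jJ).
have := HE (j |` J)%fset A'.
rewrite set_fsetU set_fset1 bigcap_setU bigcap_set1 big_fsetU1//= -setIA EB.
rewrite /A' eqxx -/A' => HJ.
rewrite (eq_bigcapr (F := fun i => Y i @^-1` A i) (G := fun i => Y i @^-1` A' i)); last first.
  by move=> i /= /A'J ->.
rewrite setIA -[in LHS]setIA HJ -?muleA; last first.
  by move=> i [->//|/JD[]].
congr (_ * (_ * _)); apply: eq_big_seq => i iJ.
by rewrite -/(A' i) A'J.
Qed.

Lemma indep_event_bigcup (K : countType) (D : set I) (E : K -> set T) :
  trivIset setT E -> (forall k, indep_event D (E k)) ->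
  indep_event D (\bigcup_k E k).
Proof.
move=> tE HE; have mE k : measurable (E k) by have [] := HE k.
split=> [|J A JD]; first exact: measurable_bigcup_countType.
rewrite setI_bigcupl !measure_bigcup_countType//; first last.
- apply/trivIsetP => i j _ _ ij; rewrite setIACA.
  by move/trivIsetP: tE => /(_ i j Logic.I Logic.I ij) ->; rewrite set0I.
- by move=> k; apply: measurableI => //; exact: measurable_fset_bigcap.
rewrite -esumZr//; last by apply: prode_ge0.
apply: eq_esum => k _; have [_] := HE k; exact.
Qed.

(** The indices in [L] are used up, and independence of the rest of [D] survives; this allows
    repeated use, one generation after another. *)
Lemma indep_event_sum (L : seq I) (D : set I) (E : set T) (B : set S) :
  uniq L -> (forall j, j \in L -> D j) -> indep_event D E ->
  P (E `&` [set t | B (\sum_(j <- L) Y j t)%R]) =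
    P E * expect_sum (map law L) (fun a => (a \in B)%:R%:E) /\
  indep_event (D `\` [set` L]) (E `&` [set t | B (\sum_(j <- L) Y j t)%R]).
Proof.
elim: L D E B => [|j L IH] D E B /=.
  move=> _ _ HE; have -> : D `\` [set` [::]] = D.
    by apply/seteqP; split=> [i []//|i Di]; split.
  have [B0|B0] := boolP (0%R \in B).
    have -> : [set t | B (\sum_(j <- [::]) Y j t)%R] = setT.
      by apply/seteqP; split=> t //= _; rewrite big_nil; exact: set_mem.
    by rewrite setIT mule1.
  have -> : [set t | B (\sum_(j <- [::]) Y j t)%R] = set0.
    apply/seteqP; split=> t //=; rewrite big_nil.
    by move: B0; rewrite notin_setE.
  rewrite setI0 measure0 mule0; split=> //.
  split=> // J A _; by rewrite set0I measure0 mul0e.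
move=> /andP[jL uL] LD HE.
(* Splitting by the value [a] of the first variable leaves the remaining sum with the target set
   shifted by [a]. *)
pose Ea a := E `&` Y j @^-1` [set a].
pose Ba a : set S := [set b | B (a + b)%R].
have Ha a := indep_eventI [set a] (LD j (mem_head _ _)) HE.
have H a := IH (D `\ j) (Ea a) (Ba a) uL _ (Ha a).2.
have {}H a : P (Ea a `&` [set t | Ba a (\sum_(j <- L) Y j t)%R]) =
    P (Ea a) * expect_sum (map law L) (fun b => ((a + b)%R \in B)%:R%:E) /\
  indep_event (D `\` [set` j :: L]) (Ea a `&` [set t | Ba a (\sum_(j <- L) Y j t)%R]).
  have [|H1 H2] := H _ a.
    move=> i iL; split; first by apply: LD; rewrite in_cons iL orbT.
    by move=> /= ij; rewrite -ij iL in jL.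
  split.
    by rewrite H1.
  apply: indep_event_subset H2 => i [Di /=]; rewrite in_cons => /negP.
  by rewrite negb_or => /andP[/eqP ij /negP iL]; split.
have -> : E `&` [set t | B (\sum_(i <- j :: L) Y i t)%R] =
    \bigcup_a (Ea a `&` [set t | Ba a (\sum_(j <- L) Y j t)%R]).
  apply/seteqP; split=> t /=; rewrite big_cons.
    by move=> [Et Bt]; exists (Y j t).
  by move=> [a _ [[Et <-]]].
have tr : trivIset setT (fun a => Ea a `&` [set t | Ba a (\sum_(j <- L) Y j t)%R]).
  apply/trivIsetP => a b _ _ ab; rewrite -subset0 => t [[[_ /= ya] _] [[_ /= yb] _]].
  by move: ab; rewrite -ya -yb eqxx.
split; last by apply: indep_event_bigcup => // a; have [] := H a.
rewrite measure_bigcup_countType//; last by move=> a; have [_ []] := H a.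
rewrite -esumZl//; last first.
  move=> a; rewrite mule_ge0// expect_sum_ge0//.
  by move=> _ /mapP[i _ ->].
apply: eq_esum => a _.
by apply: (etrans (H a).1); rewrite (Ha a).1 muleA.
Qed.

End Independence.

(** * Powers of a matrix of spectral radius less than 1 *)

Section SpectralRadius.
Context {R : realType}.
Import Normc.

Lemma contraction_cvg0 (c : R) (x e : nat -> R) : 0 <= c < 1 ->
  (forall n, 0 <= x n) -> (forall n, x n.+1 <= c * x n + e n) ->
  e @ \oo --> (0 : R) -> x @ \oo --> (0 : R).
Proof.
move=> /andP[c0 c1] x0 xS e0; apply/cvgrPdist_le => eps eps0.
have c1' : 0 < 1 - c by rewrite subr_gt0.
have eps2 : 0 < eps / 2 by rewrite divr_gt0.
(* This threshold makes [eps / 2] the fixed point of u |-> c u + (eps / 2)(1 - c); beyond [N] only a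
   geometric term comes on top of it. *)
have /cvgrPdist_le/(_ _ (mulr_gt0 eps2 c1'))[N _ HN] := e0.
have xN k : x (N + k)%N <= eps / 2 + c ^+ k * x N.
  elim: k => [|k IH].
    by rewrite addn0 expr0 mul1r lerDr ltW.
  rewrite addnS (le_trans (xS _))//.
  have := HN (N + k)%N (leq_addr _ _); rewrite /= sub0r normrN => /ler_normlW eN.
  apply: (le_trans (lerD (ler_wpM2l c0 IH) eN)).
  by rewrite exprS le_eqVlt; apply/orP; left; apply/eqP; ring.
have cN0 : (fun k => c ^+ k * x N) @ \oo --> (0 : R).
  by rewrite -(mul0r (x N)); apply: cvgMl; apply: cvg_expr; rewrite ger0_norm.
have /cvgrPdist_le/(_ _ eps2)[K _ HK] := cN0.
exists (N + K)%N => // n /= NKn.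
rewrite sub0r normrN ger0_norm//.
have Nn : (N <= n)%N by apply: leq_trans NKn; rewrite leq_addr.
rewrite -(subnKC Nn) (le_trans (xN _))// [leRHS]splitr lerD2l.
have := HK (n - N)%N; rewrite /= sub0r normrN leq_subRL// => /(_ NKn).
exact/le_trans/ler_norm.
Qed.

Lemma normc_eigenvalue_le (p : nat) (M : 'M[R]_p) (z : R[i]) :
  eigenvalue (map_mx (real_complex R) M) z -> normc z <= spectral_radius M.
Proof.
move=> ez; apply: sup_upper_bound; last by exists z.
split; first by exists (normc z), z.
set A := map_mx _ M in ez *.
have [r Hr] := closed_field_poly_normal (char_poly A).
(* [sup] bounds a set only if the set is bounded above; the sum of the moduli of all roots of the
   characteristic polynomial is such a bound. *)
exists (\sum_(w <- r) normc w) => _ [w /= + <-].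
rewrite eigenvalue_root_char Hr rootZ ?lead_coef_eq0 ?monic_neq0 ?char_poly_monic//.
rewrite root_prod_XsubC => wr; rewrite (big_rem w)//= lerDl.
by apply: sumr_ge0 => u _; case: u => a b; apply: sqrtr_ge0.
Qed.

(** Cayley-Hamilton takes the place of the Jordan form: the product of all factors [A - z] is 0, and
    peeling them off leads to [A ^+ n] itself. *)
Lemma expmx_cvg0 (p : nat) (M : 'M[R]_p.+1) i j : spectral_radius M < 1 ->
  (fun n => (M ^+ n) i j) @ \oo --> (0 : R).
Proof.
move=> rM; pose A := map_mx (real_complex R) M.
have [r Hr] := closed_field_poly_normal (char_poly A).
have r1 z : z \in r -> normc z < 1.
  move=> zr; apply: le_lt_trans rM; apply: normc_eigenvalue_le.
  rewrite eigenvalue_root_char Hr rootZ ?lead_coef_eq0 ?monic_neq0 ?char_poly_monic//.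
  by rewrite root_prod_XsubC.
pose entry (B : 'M[R[i]]_p.+1) n := normc ((A ^+ n * B) i j).
have normc_ge0 (u : R[i]) : 0 <= normc u by case: u => a b; apply: sqrtr_ge0.
(* Factors of the characteristic polynomial are peeled off one at a time: if
   [A ^+ n * ((A - z) * B)] tends to 0 and [|z| < 1], so does [A ^+ n * B]. *)
have step z B : normc z < 1 ->
    entry ((A - z%:A) * B) @ \oo --> (0 : R) -> entry B @ \oo --> (0 : R).
  move=> z1; apply: (contraction_cvg0 (c := normc z)) => [|n|n].
  - by rewrite normc_ge0.
  - exact: normc_ge0.
  - rewrite /entry -normcM.
    apply: (le_trans _ (le_normcD _ _)).
    rewrite mulrA mulrBr mulrBl exprSr -scalerAr mulr1 -scalerAl !mxE.
    by rewrite addrCA subrr addr0.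
have peel s B : {subset s <= r} ->
    entry (horner_mx A (\prod_(z <- s) ('X - z%:P)) * B) @ \oo --> (0 : R) ->
    entry B @ \oo --> (0 : R).
  elim: s B => [|z s IH] B sr; first by rewrite big_nil rmorph1 mul1r.
  rewrite big_cons mulrC rmorphM/= rmorphB/= horner_mx_X horner_mx_C -mulrA.
  move/IH => H; apply: (step z); first by apply: r1; apply: sr; rewrite mem_head.
  rewrite scalemx1; apply: H => w ws; apply: sr; by rewrite in_cons ws orbT.
have A0 : entry 1 @ \oo --> (0 : R).
  apply: (peel r) => //.
  have -> : horner_mx A (\prod_(z <- r) ('X - z%:P)) = 0.
    by rewrite -(Cayley_Hamilton A) Hr (monicP (char_poly_monic A)) scale1r.
  rewrite /entry mul0r; under eq_fun do rewrite mulr0 mxE normc0.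
  exact: cvg_cst.
(* The embedding into the complex numbers preserves absolute values, so the convergence descends to
   [M]. *)
apply/cvgrPdist_le => eps eps0.
have /cvgrPdist_le/(_ _ eps0) := A0; apply: filterS => n.
rewrite !sub0r !normrN /entry mulr1 /A -rmorphXn /= mxE ger0_norm//.
by rewrite /= expr0n/= addr0 sqrtr_sqr.
Qed.

End SpectralRadius.

(** * The transition operator *)

Section Types.
Context {p : nat}.
Implicit Types x y : 'cV[nat]_p.

Definition types x : seq 'I_p :=
  [seq i | i <- enum 'I_p, _ <- iota 0 (x i ord0)].

Lemma types0 : types 0 = [::].
Proof. by rewrite /types; elim: (enum _) => //= i s ->; rewrite mxE. Qed.

Lemma types_nil x : types x = [::] -> x = 0.
Proof.
move=> x0; apply/colP => i; rewrite mxE.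
case E : (x i ord0) => [//|n]; have : i \in types x.
  by apply/allpairsPdep; exists i, 0%N; rewrite mem_enum mem_iota E.
by rewrite x0.
Qed.

Lemma perm_typesD x y : perm_eq (types (x + y)) (types x ++ types y).
Proof.
have cat_nseq (i : 'I_p) : [seq i | _ <- iota 0 ((x + y)%R i ord0)] =
    [seq i | _ <- iota 0 (x i ord0)] ++ [seq i | _ <- iota 0 (y i ord0)].
  have E (s : seq nat) : [seq i | _ <- s] = nseq (size s) i by elim: s => //= _ s ->.
  by rewrite !E !size_iota mxE nseqD.
rewrite /types; elim: (enum _) => //= i s IH.
rewrite cat_nseq -!catA perm_cat2l perm_sym perm_catCA perm_cat2l perm_sym.
exact: IH.
Qed.

Lemma sum_types (V : nmodType) (F : 'I_p -> V) x :
  \sum_(i <- types x) F i = \sum_(i < p) F i *+ x i ord0.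
Proof.
rewrite big_allpairs_dep big_enum/=; apply: eq_bigr => i _.
by rewrite big_const_seq count_predT size_iota iter_addr_0.
Qed.

End Types.

(** Weierstrass product inequality, the union bound for independent events of probability [s i]. The
    induction step expands the product of [1 - s i] and one minus the remaining product, which is
    nonnegative. *)
Lemma bernoulli_seq (R : realFieldType) (I : eqType) (l : seq I) (s : I -> R) :
  (forall i, 0 <= s i <= 1) ->
  1 <= \prod_(i <- l) s i + \sum_(i <- l) (1 - s i).
Proof.
move=> s01; elim: l => [|i l IH]; first by rewrite !big_nil addr0.
rewrite !big_cons.
have p0 : 0 <= \prod_(i <- l) s i.
  by apply: prodr_ge0 => j _; have /andP[] := s01 j.
have p1 : \prod_(i <- l) s i <= 1 by apply: prodr_ile1 => j _; exact: s01.
have /andP[s0 s1] := s01 i.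
have : 0 <= (1 - s i) * (1 - \prod_(i <- l) s i) by rewrite mulr_ge0 ?subr_ge0.
lra.
Qed.

Section Kernel.
Context {R : realType} {p : nat}.
Local Notation S := 'cV[nat]_p.
Variables (lxi : 'I_p -> S -> \bar R) (leta : S -> \bar R).
Hypothesis lxi0 : forall i a, (0 <= lxi i a)%E.
Hypothesis leta0 : forall a, (0 <= leta a)%E.
Hypothesis lxi1 : forall i, (\esum_(a in [set: S]) lxi i a = 1)%E.
Hypothesis leta1 : (\esum_(a in [set: S]) leta a = 1)%E.
Local Open Scope ereal_scope.
Implicit Types (x y a b : S) (h : S -> \bar R).

Definition step_laws x := [seq lxi i | i <- types x] ++ [:: leta].
(** The transition operator: the expectation of [h] one step after state [x]. *)
Definition step h x := expect_sum (step_laws x) h.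

Lemma branch_laws0 (l : seq 'I_p) : nneg_all (map lxi l).
Proof. by move=> _ /mapP[i _ ->]. Qed.

Lemma step_laws0 x : nneg_all (step_laws x).
Proof.
move=> f; rewrite mem_cat => /orP[/branch_laws0//|].
by rewrite mem_seq1 => /eqP ->.
Qed.

Hint Resolve step_laws0 branch_laws0 : core.

Lemma step_ge0 h : (forall a, 0 <= h a) -> forall x, 0 <= step h x.
Proof. by move=> h0 x; exact: expect_sum_ge0. Qed.

Lemma iter_step_ge0 n h : (forall a, 0 <= h a) -> forall x, 0 <= iter n step h x.
Proof. by move=> h0; elim: n => //= n IH; exact: step_ge0. Qed.

Lemma stepE h x : (forall a, 0 <= h a) ->
  step h x = \esum_(z in [set: S]) step (fun a => (a == z)%:R%:E) x * h z.
Proof. by move=> h0; rewrite /step (esum_expect_sum id). Qed.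

Lemma step1 x : step (fun=> 1) x = 1.
Proof.
apply: expect_sum1 => f; rewrite mem_cat => /orP[/mapP[i _ ->]//|].
by rewrite mem_seq1 => /eqP ->.
Qed.

(** * The branching property and extinction probabilities *)

(** Branching property: the offspring of [a] are summed separately, and the immigration is counted
    with [b]. *)
Lemma step_add h a b : (forall c, 0 <= h c) ->
  step h (a + b)%R =
  expect_sum (map lxi (types a)) (fun u => step (fun v => h (u + v)%R) b).
Proof.
move=> h0; rewrite /step /step_laws !expect_sum_cat.
rewrite (expect_sum_perm _ _ (perm_typesD a b))//; last first.
  by move=> c; apply: expect_sum_ge0 => // f; rewrite mem_seq1 => /eqP ->.
rewrite map_cat expect_sum_cat; apply: eq_expect_sum => u.
rewrite expect_sum_cat; apply: eq_expect_sum => v.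
by apply: eq_expect_sum => c; rewrite addrA.
Qed.

(* [ext_prob n i] is the probability that the descendants of one individual of
   type [i], immigration excluded, have died out by generation [n]. *)
Definition all_ext (s : 'I_p -> R) a : R := \prod_(i <- types a) s i.

Fixpoint ext_prob n : 'I_p -> R :=
  if n is m.+1 then
    fun i => fine (\esum_(a in [set: S]) lxi i a * (all_ext (ext_prob m) a)%:E)
  else fun=> 0%R.

Lemma all_extD s a b : all_ext s (a + b)%R = (all_ext s a * all_ext s b)%R.
Proof. by rewrite /all_ext (perm_big _ (perm_typesD a b)) big_cat. Qed.

Lemma all_ext0 s : all_ext s 0%R = 1%R.
Proof. by rewrite /all_ext types0 big_nil. Qed.

Lemma all_ext_ge0 s a : (forall i, 0 <= s i <= 1)%R -> (0 <= all_ext s a)%R.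
Proof. by move=> s01; apply: prodr_ge0 => j _; have /andP[] := s01 j. Qed.

Lemma all_ext_le1 s a : (forall i, 0 <= s i <= 1)%R -> (all_ext s a <= 1)%R.
Proof. by move=> s01; apply: prodr_ile1 => j _; exact: s01. Qed.

Lemma esum_all_ext s i : (forall i, 0 <= s i <= 1)%R ->
  0 <= \esum_(a in [set: S]) lxi i a * (all_ext s a)%:E <= 1.
Proof.
move=> s01; apply/andP; split.
  by apply: esum_ge0 => a _; rewrite mule_ge0// lee_fin all_ext_ge0.
rewrite -(lxi1 i); apply: le_esum => a _.
by rewrite -[leRHS]mule1 lee_wpmul2l// lee_fin all_ext_le1.
Qed.

Lemma ext_prob01 n i : (0 <= ext_prob n i <= 1)%R.
Proof.
elim: n i => [|n IH] i /=; first by rewrite lexx ler01.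
have /andP[E0 E1] := esum_all_ext i IH.
rewrite fine_ge0//= -lee_fin fineK// ge0_fin_numE//.
exact: le_lt_trans E1 (ltry _).
Qed.

(** The sum lies in [0, 1], so [fine] in [ext_prob] does not alter it. *)
Lemma ext_probE n i : (ext_prob n.+1 i)%:E =
  \esum_(a in [set: S]) lxi i a * (all_ext (ext_prob n) a)%:E.
Proof.
have /andP[E0 E1] := esum_all_ext i (ext_prob01 n).
by rewrite fineK// ge0_fin_numE//; exact: le_lt_trans E1 (ltry _).
Qed.

(* With probability [all_ext (ext_prob n) a] the initial subpopulation [a] has
   left no descendants after [n] steps, and then the process behaves as if it
   had been started from [b]. *)
Lemma iter_step_ext n h a b : (forall c, 0 <= h c) ->
  iter n step h b * (all_ext (ext_prob n) a)%:E <= iter n step h (a + b)%R.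
Proof.
move=> h0; elim: n a b => [|n IH] a b /=.
  (* At time 0 the extinction probabilities are 0, so the left side vanishes unless [a] is empty. *)
  rewrite /all_ext; case E : (types a) => [|i s].
    by rewrite big_nil mule1 (types_nil E) add0r.
  by rewrite big_cons mul0r mule0.
have hn0 := iter_step_ge0 n h0.
have s01 := ext_prob01 n.
rewrite step_add//.
(* As [all_ext] is multiplicative, its expectation at the offspring [u] of [a] is the product of
   [ext_prob n.+1] over the individuals of [a]. *)
have -> : step (iter n step h) b * (all_ext (ext_prob n.+1) a)%:E =
   expect_sum (map lxi (types a))
     (fun u => (all_ext (ext_prob n) u)%:E * step (iter n step h) b).
  rewrite expect_sumZ//; [|by move=> c; rewrite lee_fin all_ext_ge0|exact: step_ge0].
  rewrite muleC expect_sum_mult//.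
  - rewrite big_map /all_ext -prodEFin.
    by congr (_ * _); apply: eq_bigr => i _; rewrite ext_probE.
  - by move=> c; rewrite lee_fin all_ext_ge0.
  - by rewrite all_ext0.
  - by move=> c d; rewrite all_extD EFinM.
apply: le_expect_sum => //.
  by move=> c; rewrite mule_ge0 ?lee_fin ?all_ext_ge0// step_ge0.
(* For fixed offspring [u], the induction hypothesis is applied at each successor of [b]. *)
move=> u; rewrite muleC /step -expect_sumZ// ?lee_fin ?all_ext_ge0//.
apply: le_expect_sum => // c.
by rewrite mule_ge0// lee_fin all_ext_ge0.
Qed.

Lemma iter_step_delta_ge0 n x y :
  0 <= iter n step (fun a => (a == y)%:R%:E) x :> \bar R.
Proof. by apply: iter_step_ge0 => a; rewrite lee_fin. Qed.

Lemma iter_stepE n h x : (forall a, 0 <= h a) ->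
  iter n step h x =
  \esum_(y in [set: S]) iter n step (fun a => (a == y)%:R%:E) x * h y.
Proof.
move=> h0; elim: n x => [|n IH] x /=; first by rewrite esum_delta.
have d0 := iter_step_delta_ge0.
rewrite stepE; last exact: iter_step_ge0.
transitivity (\esum_(y in [set: S]) \esum_(z in [set: S])
    (step (fun a => (a == z)%:R%:E) x * iter n step (fun a => (a == y)%:R%:E) z * h y)).
  rewrite exchange_esum => [|y z]; last first.
    by rewrite mule_ge0// mule_ge0//; exact: (d0 1%N).
  apply: eq_esum => z _; rewrite IH -esumZl//.
  - by apply: eq_esum => y _; rewrite muleA.
  - exact: (d0 1%N).
  - by move=> y; rewrite mule_ge0.
apply: eq_esum => y _; rewrite esumZr//; last first.
  by move=> z; rewrite mule_ge0//; exact: (d0 1%N).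
by rewrite [in RHS]stepE// => a; exact: d0.
Qed.

Lemma iter_step1 n x : iter n step (fun=> 1) x = 1.
Proof.
elim: n x => //= n IH x; rewrite -[RHS](step1 x).
by apply: eq_expect_sum => a; exact: IH.
Qed.

Lemma iter_step_pos n h x : (forall a, 0 <= h a) -> 0 < iter n step h x ->
  exists y, 0 < iter n step (fun a => (a == y)%:R%:E) x /\ 0 < h y.
Proof.
move=> h0; rewrite iter_stepE// lt_neqAle => /andP[+ _] => /eqP nz.
apply: contrapT => /forallNP no; apply: nz.
rewrite esum1// => y _; have := no y.
have := iter_step_delta_ge0 n x y; rewrite le_eqVlt => /orP[/eqP <-|py].
  by rewrite mul0e.
have := h0 y; rewrite le_eqVlt => /orP[/eqP <-|hy]; first by rewrite mule0.
by case.
Qed.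

Lemma iter_step_ge_term n h x y : (forall a, 0 <= h a) ->
  iter n step (fun a => (a == y)%:R%:E) x * h y <= iter n step h x.
Proof.
move=> h0; rewrite (iter_stepE _ _ h0).
apply: (@esum_ge_term _ _ (fun y => iter n step (fun a => (a == y)%:R%:E) x * h y)).
by move=> z; rewrite mule_ge0// iter_step_delta_ge0.
Qed.

(** A lineage outlives generation n+1 only if the lineage of some child outlives n generations;
    [bernoulli_seq] over the children gives the union bound, and expectations bring in [M]. *)
Lemma ext_prob_mean (M : 'M[R]_p) n i :
  (forall i j, \esum_(a in [set: S]) lxi i a * (a j ord0)%:R%:E <= (M i j)%:E) ->
  (1 - ext_prob n.+1 i <= \sum_j M i j * (1 - ext_prob n j))%R.
Proof.
move=> HM; rewrite lerBlDl -lee_fin EFinD ext_probE.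
have s01 := ext_prob01 n.
have s1 j : (0 <= 1 - ext_prob n j)%R by rewrite subr_ge0; have /andP[] := s01 j.
have t0 j a : 0 <= lxi i a * ((a j ord0)%:R%:E * (1 - ext_prob n j)%:E).
  by rewrite mule_ge0// mule_ge0 ?lee_fin.
apply: (@le_trans _ _ (\esum_(a in [set: S]) lxi i a * (all_ext (ext_prob n) a)%:E +
   \sum_j \esum_(a in [set: S]) lxi i a * ((a j ord0)%:R%:E * (1 - ext_prob n j)%:E))).
  rewrite -esum_sum// -esumD; last 2 first.
  - by move=> a _; rewrite mule_ge0// lee_fin all_ext_ge0.
  - by move=> a _; apply: sume_ge0 => j _.
  rewrite -(lxi1 i); apply: le_esum => a _.
  rewrite -ge0_sume_distrr; last by move=> j _; rewrite mule_ge0 ?lee_fin.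
  rewrite -ge0_muleDr ?lee_fin ?all_ext_ge0//; last first.
    by apply: sume_ge0 => j _; rewrite mule_ge0 ?lee_fin.
  rewrite -[leLHS]mule1 lee_wpmul2l// sumEFin -EFinD lee_fin.
  apply: le_trans (bernoulli_seq (types a) s01) _.
  rewrite sum_types lerD2l; apply: ler_sum => j _.
  by rewrite mulr_natl.
rewrite leeD2l// -sumEFin; apply: lee_sum => j _.
under eq_esum do rewrite muleA.
rewrite esumZr ?lee_fin//; last by move=> a; rewrite mule_ge0// lee_fin.
by rewrite EFinM lee_wpmul2r ?lee_fin.
Qed.


(** * The n-step transition probabilities and the absorbing class *)

Variable Q : S -> S -> \bar R.
Hypothesis QE : forall x y, Q x y = step (fun a => (a == y)%:R%:E) x.

Lemma nstepE n x y : nstep Q n x y = iter n step (fun a => (a == y)%:R%:E) x.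
Proof.
elim: n x => //= n IH x; rewrite stepE; last by move=> a; exact: iter_step_delta_ge0.
by apply: eq_esum => z _; rewrite QE IH.
Qed.

Lemma nstep_ge0 n x y : 0 <= nstep Q n x y.
Proof. by rewrite nstepE; exact: iter_step_delta_ge0. Qed.

Lemma iter_nstepE m n x z :
  nstep Q (m + n) x z = iter m step (fun y => nstep Q n y z) x.
Proof.
rewrite nstepE iterD; congr (iter m step _ x).
by apply/funext => y; rewrite nstepE.
Qed.

Lemma nstep_gt0_trans m n x y z :
  0 < nstep Q m x y -> 0 < nstep Q n y z -> 0 < nstep Q (m + n) x z.
Proof.
move=> xy yz; rewrite iter_nstepE.
apply: lt_le_trans (iter_step_ge_term m x y (fun a => nstep_ge0 n a z)).
by rewrite mule_gt0// -nstepE.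
Qed.

Lemma nstep_gt0_ex n x : exists y, 0 < nstep Q n x y.
Proof.
have [] := @iter_step_pos n (fun=> 1) x; first by [].
  by rewrite iter_step1.
by move=> y [xy _]; exists y; rewrite nstepE.
Qed.

Hypothesis ext_prob_cvg1 : forall i, ext_prob ^~ i @ \oo --> (1 : R)%R.

Lemma all_ext_cvg1 a : (fun n => all_ext (ext_prob n) a) @ \oo --> (1 : R)%R.
Proof.
rewrite /all_ext; elim: (types a) => [|i l IH].
  rewrite (_ : (fun n => _) = fun=> 1%R); first exact: cvg_cst.
  by apply/funext => n; rewrite big_nil.
rewrite (_ : (fun n => _) =
    (ext_prob ^~ i) \* fun n => \prod_(j <- l) ext_prob n j)%R; last first.
  by apply/funext => n; rewrite big_cons.
by have := cvgM (ext_prob_cvg1 i) IH; rewrite mulr1; apply.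
Qed.

(** There are finitely many types, so one [K] makes all [ext_prob n i] positive, and hence their
    products for every population [a]. *)
Lemma all_ext_pos : exists K, forall n a, (K <= n)%N ->
  (0 < all_ext (ext_prob n) a)%R.
Proof.
have : \forall n \near \oo, forall i, (0 < ext_prob n i)%R.
  by apply: filter_forall => i; apply: cvgr_gt (ext_prob_cvg1 i) _ ltr01.
move=> [K _ HK]; exists K => n a Kn; apply: prodr_gt0 => i _.
exact: HK.
Qed.

(** The lower bound in the last clause tends to 1 by [all_ext_cvg1]; almost sure absorption rests on
    it. *)
Lemma aperiodic_absorbing_class : exists C : set S,
  [/\ communication_class Q C, aperiodic Q C &
      exists K, forall n x, (K <= n)%N ->
        (all_ext (ext_prob n) x)%:E <= iter n step (fun y => (y \in C)%:R%:E) x].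
Proof.
have [K HK] := all_ext_pos.
(* From any state, the initial individuals and their descendants have died out
   after [n >= K] steps with positive probability, and then the state is one
   that is accessible from 0. *)
have from0 n x y : (K <= n)%N -> 0 < nstep Q n 0%R y -> 0 < nstep Q n x y.
  move=> Kn n0y; rewrite nstepE -[x]addr0.
  apply: lt_le_trans (iter_step_ext n x 0%R _); last by move=> c; rewrite lee_fin.
  by rewrite -nstepE mule_gt0// lte_fin HK.
have [z K0z] := nstep_gt0_ex K 0%R.
(* The first [n - K] steps are arbitrary; the last [K] can lead to [z] from any state. *)
have to_z n x : (K <= n)%N -> 0 < nstep Q n x z.
  move=> Kn; have [y xy] := nstep_gt0_ex (n - K) x.
  by rewrite -(subnK Kn); apply: nstep_gt0_trans xy _; exact: from0.
exists [set y | communicate Q z y]; split; first by exists z.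
  move=> x [[m zx] _]; split=> [n _|e He]; first exact: dvd1n.
  (* [x] can return through [z] in [n + m] steps for all large [n], so [e] divides two consecutive
     integers. The 1 in the maximum keeps the return time positive even if [m] is 0. *)
  have cyc n : (maxn K 1 <= n)%N -> (e %| n + m)%N.
    rewrite geq_max => /andP[Kn n0]; apply: He; split; first by rewrite addn_gt0 n0.
    by apply: nstep_gt0_trans zx; exact: to_z.
  have := cyc (maxn K 1).+1 (leqnSn _).
  by rewrite addSn -addn1 dvdn_addr// cyc.
exists K => n x Kn.
have C0 : forall y : S, 0 <= (y \in [set y | communicate Q z y])%:R%:E :> \bar R.
  by move=> y; rewrite lee_fin.
rewrite -[x in leRHS]addr0.
apply: le_trans (iter_step_ext n x 0%R C0).
rewrite -[leLHS]mul1e lee_wpmul2r//.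
  by rewrite lee_fin ltW// HK.
(* The law at time [n] from 0 has mass 1 and charges only the class: such a [y] is reached from [z]
   in [n] steps and leads back to [z] in [K]. *)
rewrite -(iter_step1 n 0%R) iter_stepE// [leRHS]iter_stepE//; apply: le_esum => y _.
have := iter_step_delta_ge0 n 0%R y; rewrite le_eqVlt => /orP[/eqP <-|py].
  by rewrite !mul0e.
rewrite mem_set//; split; last by exists K; exact: to_z.
by exists n; apply: from0 => //; rewrite nstepE.
Qed.

End Kernel.

(** Iterating [ext_prob_mean] bounds the survival probabilities by the row sums of [M ^+ n]; at time
    0 both are 1, and nonnegative entries preserve the bound. *)
Lemma ext_prob_cvg (R : realType) (p : nat) (lxi : 'I_p.+1 -> 'cV[nat]_p.+1 -> \bar R)
    (M : 'M[R]_p.+1) i :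
  (forall i a, 0 <= lxi i a)%E ->
  (forall i, \esum_(a in [set: 'cV[nat]_p.+1]) lxi i a = 1)%E ->
  (forall i j, \esum_(a in [set: 'cV[nat]_p.+1])
     lxi i a * (a j ord0)%:R%:E <= (M i j)%:E)%E ->
  spectral_radius M < 1 -> ext_prob lxi ^~ i @ \oo --> (1 : R).
Proof.
move=> lxi0 lxi1 HM rM.
have M0 j k : 0 <= M j k.
  rewrite -lee_fin (le_trans _ (HM j k))// esum_ge0// => a _.
  by rewrite mule_ge0// lee_fin.
have bound n j : 1 - ext_prob lxi n j <= \sum_k (M ^+ n) j k.
  elim: n j => [|n IH] j.
    rewrite expr0 subr0 (bigD1 j)//= mxE eqxx lerDl sumr_ge0// => k _.
    by rewrite mxE ler0n.
  apply: le_trans (ext_prob_mean lxi0 lxi1 n j HM) _.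
  rewrite exprS; under [leRHS]eq_bigr do rewrite mxE.
  rewrite exchange_big/=; apply: ler_sum => k _.
  by rewrite -mulr_sumr ler_wpM2l.
have sum0 : (fun n => \sum_k (M ^+ n) i k) @ \oo --> (0 : R).
  have := cvg_big (P := predT) (r := index_enum 'I_p.+1) (@add_continuous R) _
    (fun k _ => expmx_cvg0 i k rM).
  by move=> /(_ 0 _); rewrite big1//; apply.
apply: (squeeze_cvgr (f := fun n => 1 - \sum_k (M ^+ n) i k) (h := fun=> 1)).
- near=> n; have /andP[_ ->] := ext_prob01 lxi0 lxi1 n i.
  by rewrite andbT lerBlDr -lerBlDl bound.
- by have := cvgB (cvg_cst (1 : R)) sum0; rewrite subr0; apply.
- exact: cvg_cst.
Unshelve. all: by end_near.
Qed.

(** * Galton-Watson processes *)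

Section Process.
Context {R : realType} {p : nat}.
Implicit Types (W : gw_process R p) (x y : 'cV[nat]_p).
Local Open Scope ereal_scope.

Definition gw_fam W : gw_index p -> gw_space W -> 'cV[nat]_p :=
  gw_family (@gw_X0 R p W) (@gw_xi R p W) (@gw_eta R p W).

Definition gw_law W : gw_index p -> 'cV[nat]_p -> \bar R :=
  law (gw_P W) (@gw_fam W).

Definition offspring_law W (i : 'I_p) := gw_law W (inl (inr (i, 0%N, 0%N))).
Definition innovation_law W := gw_law W (inr 0%N).

(** Indices of the driving vectors that lead from state [x] at time [m] to the state at time
    [m.+1]. *)
Definition step_index (m : nat) x : seq (gw_index p) :=
  [seq inl (inr (i, m, k)) | i <- enum 'I_p, k <- iota 0 (x i ord0)] ++ [:: inr m].

Lemma step_index_uniq m x : uniq (step_index m x).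
Proof.
rewrite cat_uniq/= orbF andbT; apply/andP; split; last first.
  by apply/negP => /allpairsPdep[i [k []]].
apply: allpairs_uniq_dep; first exact: enum_uniq.
  by move=> i _; exact: iota_uniq.
by move=> [i k] [j l] _ _ /= [-> ->].
Qed.

Lemma sum_step_index W m x w :
  (\sum_(j <- step_index m x) gw_fam j w =
   \sum_(i < p) \sum_(k < x i ord0) @gw_xi R p W i m k w + gw_eta m w)%R.
Proof.
rewrite big_cat big_seq1 big_allpairs_dep big_enum; congr (_ + _)%R.
apply: eq_bigr => i _; rewrite -(big_mkord predT (fun k => gw_xi i m k w)).
by rewrite /index_iota subn0.
Qed.

(** Time homogeneity: a single operator, formed from the laws of [W], governs every step of every
    [W']. *)
Lemma step_index_laws W W' m x : same_dynamics W W' ->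
  [seq gw_law W' j | j <- step_index m x] =
  step_laws (offspring_law W) (innovation_law W) x.
Proof.
move=> [Hxi Heta]; rewrite /step_index /step_laws map_cat; congr (_ ++ [:: _]).
  rewrite map_allpairs /types map_allpairs; apply: eq_allpairs => // i k.
  apply/funext => a; rewrite /offspring_law /gw_law /law /=.
  by rewrite (Hxi i [set a]); exact: gw_xi_ident.
apply/funext => a; rewrite /innovation_law /gw_law /law /=.
by rewrite (Heta [set a]); exact: gw_eta_ident.
Qed.

Lemma gw_law_ge0 W j a : 0 <= gw_law W j a.
Proof. exact: measure_ge0. Qed.

Lemma esum_gw_law W j : \esum_(a in [set: 'cV[nat]_p]) gw_law W j a = 1.
Proof.
rewrite -measure_bigcup_countType.
- rewrite -(@probability_setT _ _ _ (gw_P W)); congr (gw_P W _).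
  by apply/seteqP; split=> w // _; exists (gw_fam j w).
- by move=> a; exact: gw_random.
- by apply/trivIsetP => a b _ _ ab; rewrite -subset0 => w [/= wa wb];
    move: ab; rewrite -wa -wb eqxx.
Qed.

Lemma same_dynamics_refl W : same_dynamics W W.
Proof. by split. Qed.

Lemma gw_transE W x y : gw_trans W x y =
  step (offspring_law W) (innovation_law W) (fun a => (a == y)%:R%:E) x.
Proof.
have [] := indep_event_sum (@gw_random R p W) [set y] (step_index_uniq 0 x)
  (fun _ _ => Logic.I) (indep_eventT (@gw_independent R p W)).
rewrite setTI probability_setT mul1e.
rewrite (step_index_laws _ _ (same_dynamics_refl W)) /step => + _.
under [X in _ = X -> _]eq_expect_sum do rewrite in_set1.
move=> <-; congr (gw_P W _).
by apply/funext => w /=; rewrite sum_step_index.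
Qed.

(** * The Markov property and the law at a given time *)

Definition future (m : nat) : set (gw_index p) :=
  [set j | match j with
           | inl (inl _) => False
           | inl (inr (_, n, _)) => (m <= n)%N
           | inr n => (m <= n)%N
           end].

Lemma step_index_future m x j : j \in step_index m x -> future m j.
Proof.
rewrite mem_cat => /orP[/allpairsPdep[i [k [_ _ ->]]]|]; first exact: leqnn.
by rewrite mem_seq1 => /eqP ->; exact: leqnn.
Qed.

Lemma future_subS m x : future m.+1 `<=` future m `\` [set` step_index m x].
Proof.
move=> j jm; split.
  by move: j jm => [[//|[[i n] k]]|n]; exact: ltnW.
rewrite /= mem_cat => /orP[/allpairsPdep[i [k [_ _ jE]]]|].
  by move: jm; rewrite jE /future /= ltnn.
by rewrite mem_seq1 => /eqP jE; move: jm; rewrite jE /future /= ltnn.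
Qed.

(** Fixing the state at time [m] replaces a random number of summands by the fixed list
    [step_index m x]. *)
Lemma gw_X_eqS W m y : [set w | gw_X m.+1 w = y] =
  \bigcup_x ([set w : gw_space W | gw_X m w = x] `&`
    [set w | [set y] (\sum_(j <- step_index m x) gw_fam j w)%R]).
Proof.
apply/seteqP; split=> w /=.
  by move=> <-; exists (gw_X m w) => //; split=> //=; rewrite sum_step_index.
by move=> [x _ [<- <-]]; rewrite /= sum_step_index.
Qed.

Lemma gw_X_cells W m (E : 'cV[nat]_p -> set (gw_space W)) :
  trivIset setT (fun x => [set w | gw_X m w = x] `&` E x).
Proof.
apply/trivIsetP => a b _ _ ab; rewrite -subset0 => w [[/= wa _] [/= wb _]].
by move: ab; rewrite -wa -wb eqxx.
Qed.

(** Markov property: each cell of [gw_X_eqS] uses up the indices in [step_index m x] and stays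
    independent of [future m.+1]. *)
Lemma indep_gw_X W m x :
  indep_event (gw_P W) (@gw_fam W) (future m) [set w | gw_X m w = x].
Proof.
have rY := @gw_random R p W.
elim: m x => [|m IH] y.
  have [_] := indep_eventI rY [set y] (j := inl (inl tt)) Logic.I
    (indep_eventT (@gw_independent R p W)).
  rewrite setTI; apply: indep_event_subset.
  by move=> j j0; split=> //= jE; rewrite jE in j0.
rewrite gw_X_eqS; apply: indep_event_bigcup => //; first exact: gw_X_cells.
move=> x; have [_] := indep_event_sum rY [set y] (step_index_uniq m x)
  (@step_index_future m x) (IH x).
by apply: indep_event_subset; exact: future_subS.
Qed.

Lemma measurable_gw_X W m (B : set 'cV[nat]_p) :
  measurable [set w : gw_space W | B (gw_X m w)].
Proof.
rewrite (_ : mkset _ = \bigcup_x ([set w | gw_X m w = x] `&` [set w | B x])).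
  apply: measurable_bigcup_countType => x; apply: measurableI.
    by have [] := indep_gw_X W m x.
  have [Bx|nBx] := pselect (B x).
    by rewrite (_ : mkset _ = setT)//; apply/seteqP; split.
  by rewrite (_ : mkset _ = set0)//; apply/seteqP; split.
apply/seteqP; split=> w /=; first by move=> Bw; exists (gw_X m w).
by move=> [x _ [-> ]].
Qed.

Lemma prob_gw_X_in W m (B : set 'cV[nat]_p) :
  gw_P W [set w | B (gw_X m w)] =
  \esum_(x in [set: 'cV[nat]_p]) gw_P W [set w | gw_X m w = x] * (x \in B)%:R%:E.
Proof.
rewrite (_ : mkset _ = \bigcup_x ([set w | gw_X m w = x] `&` [set w | B x])).
  rewrite measure_bigcup_countType; last exact: gw_X_cells.
    apply: eq_esum => x _; case: (boolP (x \in B)) => [/set_mem Bx|].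
      rewrite (_ : [set w | B x] = setT) ?setIT ?mule1//.
      by apply/seteqP; split.
    rewrite notin_setE => nBx.
    rewrite (_ : [set w | B x] = set0) ?setI0 ?measure0 ?mule0//.
    by apply/seteqP; split.
  move=> x; rewrite (_ : _ `&` _ = [set w | (B `&` [set x]) (gw_X m w)]).
    exact: measurable_gw_X.
  by apply/seteqP; split=> w /=; [move=> [<- ?]|move=> [? <-]].
apply/seteqP; split=> w /=; first by move=> Bw; exists (gw_X m w).
by move=> [x _ [-> ]].
Qed.

(** Split by the state at time [m], which is independent of the vectors of that step; Tonelli then
    collects the point masses into [step]. *)
Lemma esum_gw_XS W W' m h : same_dynamics W W' -> (forall a, 0 <= h a) ->
  \esum_(x in [set: 'cV[nat]_p]) gw_P W' [set w | gw_X m.+1 w = x] * h x =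
  \esum_(x in [set: 'cV[nat]_p]) gw_P W' [set w | gw_X m w = x] *
    step (offspring_law W) (innovation_law W) h x.
Proof.
move=> WW' h0; have xi0 i := gw_law_ge0 W (inl (inr (i, 0%N, 0%N))).
have eta0 := gw_law_ge0 W (inr 0%N).
have d0 x y : 0 <= step (offspring_law W) (innovation_law W)
    (fun a => (a == y)%:R%:E) x.
  by apply: step_ge0 => // a; rewrite lee_fin.
transitivity (\esum_(y in [set: 'cV[nat]_p]) \esum_(x in [set: 'cV[nat]_p])
    (gw_P W' [set w | gw_X m w = x] *
     (step (offspring_law W) (innovation_law W) (fun a => (a == y)%:R%:E) x * h y))).
  apply: eq_esum => y _; rewrite gw_X_eqS measure_bigcup_countType; last 2 first.
  - move=> x; have [_ []//] := indep_event_sum (@gw_random R p W') [set y]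
      (step_index_uniq m x) (@step_index_future m x) (indep_gw_X W' m x).
  - exact: gw_X_cells.
  rewrite -esumZr//; apply: eq_esum => x _; rewrite muleA; congr (_ * _).
  have [+ _] := indep_event_sum (@gw_random R p W') [set y]
    (step_index_uniq m x) (@step_index_future m x) (indep_gw_X W' m x).
  rewrite (step_index_laws _ _ WW') /step => E.
  apply: (etrans E); congr (_ * _); apply: eq_expect_sum => a.
  by rewrite in_set1.
rewrite exchange_esum; last by move=> y x; rewrite !mule_ge0.
apply: eq_esum => x _; rewrite (stepE xi0 eta0 x h0) -esumZl//.
by move=> y; rewrite mule_ge0.
Qed.

Lemma esum_gw_X W W' m h : same_dynamics W W' -> (forall a, 0 <= h a) ->
  \esum_(x in [set: 'cV[nat]_p]) gw_P W' [set w | gw_X m w = x] * h x =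
  \esum_(x in [set: 'cV[nat]_p]) gw_P W' [set w | gw_X 0 w = x] *
    iter m (step (offspring_law W) (innovation_law W)) h x.
Proof.
move=> WW'; elim: m h => [//|m IH] h h0.
rewrite (esum_gw_XS _ WW')// IH; first by rewrite iterSr.
by apply: step_ge0 => // *; exact: gw_law_ge0.
Qed.

(** Each finite partial sum is the integral of a nonnegative function over finitely many disjoint
    events, hence at most the full integral. [ext_prob_mean] asks for this upper bound. *)
Lemma offspring_law_mean W i j : gw_finite_mean W ->
  \esum_(a in [set: 'cV[nat]_p]) offspring_law W i a * (a j ord0)%:R%:E <=
  (gw_mean W i j)%:E.
Proof.
move=> /(_ i j) fin.
set f := fun w : gw_space W => ((gw_xi i 0%N 0%N w j ord0)%:R : R)%:E.
rewrite mxE fineK; last by rewrite unlock; exact: integral_fune_fin_num.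
rewrite unlock -[leRHS]/(\int[gw_P W]_(w in [set: gw_space W]) f w).
have /integrableP[mf _] := fin.
pose Y := gw_xi (g := W) i 0%N 0%N.
have mY a : measurable (Y @^-1` [set a]).
  exact: (@gw_random R p W (inl (inr (i, 0%N, 0%N)))).
have tY : trivIset setT (fun a => Y @^-1` [set a]).
  apply/trivIsetP => a b _ _ ab; rewrite -subset0 => w [/= wa wb].
  by move: ab; rewrite -wa -wb eqxx.
apply: ge_ereal_sup => _ [X [finX _] <-].
rewrite fsbig_finite//=.
apply: (@le_trans _ _ (\int[gw_P W]_(w in \big[setU/set0]_(a <- fset_set X) (Y @^-1` [set a])) f w)); last first.
  apply: ge0_subset_integral => //.
  - by apply: bigsetU_measurable.
  - by move=> w _; rewrite lee_fin.
rewrite ge0_integral_bigsetU//=; last 3 first.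
- exact: sub_trivIset tY.
- by apply: measurable_funS mf => //; apply: measurableT.
- by move=> w _; rewrite lee_fin.
rewrite le_eqVlt; apply/orP; left; apply/eqP; apply: eq_bigr => a _.
transitivity (\int[gw_P W]_(w in Y @^-1` [set a]) ((a j ord0)%:R%:E)).
  by rewrite integral_cst//= muleC.
by apply: eq_integral => w; rewrite inE /= => <-.
Qed.

End Process.

(** * Almost sure absorption from every initial distribution *)

Theorem theorem1 (R : realType) (p : nat) (hp : (0 < p)%N)
    (W : gw_process R p) (hfin : gw_finite_mean W) (hsub : subcritical W) :
  exists C : set 'cV[nat]_p,
    [/\ communication_class (gw_trans W) C,
        aperiodic (gw_trans W) C &
        forall W' : gw_process R p, same_dynamics W W' ->
          gw_P W' [set w : gw_space W' | exists n, C (gw_X n w)] = 1%E].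
Proof.
case: p => [//|p] in hp W hfin hsub *.
have xi0 i := gw_law_ge0 W (inl (inr (i, 0%N, 0%N))).
have eta0 := gw_law_ge0 W (inr 0%N).
have xi1 i := esum_gw_law W (inl (inr (i, 0%N, 0%N))).
have eta1 := esum_gw_law W (inr 0%N).
have ext1 i := ext_prob_cvg i xi0 xi1 (fun i j => offspring_law_mean i j hfin) hsub.
have [C [ccC apC [K HK]]] :=
  aperiodic_absorbing_class xi0 eta0 xi1 eta1 (@gw_transE R p.+1 W) ext1.
exists C; split=> // W' WW'.
pose B := [set w : gw_space W' | exists n, C (gw_X n w)].
have mB : measurable B.
  rewrite (_ : B = \bigcup_n [set w | C (gw_X n w)]).
    by apply: bigcupT_measurable => n; exact: measurable_gw_X.
  by apply/seteqP; split=> w /= [n]; [exists n|exists n].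
have P1 : (gw_P W' B <= 1)%E by exact: probability_le1.
apply/eqP; rewrite eq_le P1 /=.
have init1 : (\esum_(x in [set: 'cV[nat]_p.+1]) gw_P W' [set w | gw_X 0 w = x] = 1)%E.
  exact: (esum_gw_law W' (inl (inl tt))).
rewrite -[leLHS]init1.
(* The mass 1 of the initial law is a supremum of finite sums, so it suffices to treat finite sets
   [X] of initial states. *)
apply: ge_ereal_sup => _ [X [finX _] <-].
rewrite fsbig_finite//=.
pose mu x : R := fine (gw_P W' [set w | gw_X 0 w = x]).
have muE x : gw_P W' [set w | gw_X 0 w = x] = (mu x)%:E.
  rewrite fineK// fin_num_measure//.
  exact: (measurable_gw_X W' 0 [set x]).
pose b := fine (gw_P W' B).
have bE : gw_P W' B = b%:E by rewrite fineK// fin_num_measure.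
(* Being in [C] at the single time [n] already means having reached it. The bound [b] is free of
   [n], which then tends to infinity in a finite sum. *)
have approx n : (K <= n)%N ->
    \sum_(x <- fset_set X) mu x * all_ext (ext_prob (offspring_law W) n) x <= b.
  move=> Kn; rewrite -lee_fin -bE.
  apply: (@le_trans _ _ (gw_P W' [set w | C (gw_X n w)])); last first.
    apply: le_measure; rewrite ?inE//; first exact: measurable_gw_X.
    by move=> w Cw; exists n.
  have C0 x : (0 <= (x \in C)%:R%:E :> \bar R)%E by rewrite lee_fin.
  rewrite prob_gw_X_in (esum_gw_X n WW')//.
  apply: esum_ge; exists X; first by split.
  rewrite fsbig_finite//= -sumEFin; apply: lee_sum => x _.
  by rewrite EFinM -muE lee_wpmul2l// HK.
under eq_bigr do rewrite muE.
rewrite -/B bE sumEFin lee_fin.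
have cvg_sum : (fun n => \sum_(x <- fset_set X) mu x *
    all_ext (ext_prob (offspring_law W) n) x) @ \oo --> \sum_(x <- fset_set X) mu x.
  apply: (cvg_big (P := predT) (@add_continuous R)) => x _.
  by have := cvgM (cvg_cst (mu x)) (all_ext_cvg1 ext1 x); rewrite mulr1; apply.
apply: (cvgr_to_le cvg_sum); exists K => // n Kn; exact: approx.
Qed.
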